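(* Let $\mathfrak{X}$ be a saturated fusion action system of a finite $p$-group $S$ on a finite set $X$, and suppose $S$ acts faithfully on $X$. Let $G=\mathfrak{X}(1)\le\Sigma_X$ with its natural action on $X$, and identify $S$ with its image in $G$ under the injection $s\mapsto\ell_s$. Then $\mathfrak{X}$ is realized by the $G$-action on $X$; that is, $\mathfrak{X}=\mathfrak{X}_G$.
   Context: Let $p$ be a prime, $S$ a finite $p$-group, and $X$ a finite set with a left $S$-action; $\Sigma_X$ is the symmetric group on $X$, $\ell_s\in\Sigma_X$ is the permutation $x\mapsto s\cdot x$, and $c_s$ is conjugation $h\mapsto shs^{-1}$. $\mathrm{Inj}(P,Q)$ is the set of injective homomorphisms $P\to Q$. A pair $(\varphi,\sigma)\in\mathrm{Inj}(P,Q)\times\Sigma_X$ ($P,Q\le S$) is intertwined if $\sigma\ell_p\sigma^{-1}=\ell_{\varphi(p)}$ for all $p\in P$. Let $\mathfrak{U}$ be the category whose objects are all subgroups of $S$, whose morphisms $P\to Q$ are the intertwined pairs, composed componentwise. Let $\mathfrak{X}_S\subseteq\mathfrak{U}$ have the same objects and morphisms $P\to Q$ the pairs $(c_s|_P,\ell_s)$ with $s\in S$, $sPs^{-1}\le Q$. A fusion action system of $S$ on $X$ is a category $\mathfrak{X}$ with $\mathfrak{X}_S\subseteq\mathfrak{X}\subseteq\mathfrak{U}$ such that every morphism of $\mathfrak{X}$ factors as an isomorphism of $\mathfrak{X}$ followed by an inclusion $(\mathrm{incl},\mathrm{id}_X)$. Write $\mathfrak{X}(P)=\mathfrak{X}(P,P)$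 and $\mathfrak{X}(P,Q)_{\mathrm{iso}}$ for the isomorphisms; $\mathfrak{X}(1)$ (automorphisms of the trivial subgroup) is identified with a subgroup of $\Sigma_X$. The underlying fusion system $\mathcal{F}^{\mathfrak{X}}$ has the subgroups of $S$ as objects and $\mathcal{F}^{\mathfrak{X}}(P,Q)=\{\varphi : \exists\sigma,\ (\varphi,\sigma)\in\mathfrak{X}(P,Q)\}$; two subgroups are conjugate if they are isomorphic in $\mathcal{F}^{\mathfrak{X}}$. Let $C=\{s\in S:\ell_s=\mathrm{id}_X\}$, $N_S(P;X)=N_S(P)\cap C$, $Z_S(P;X)=Z_S(P)\cap C$. A subgroup $P\le S$ is fully normalized (resp. fully centralized, fully $X$-normalized, fully $X$-centralized) if $|N_S(P)|\ge|N_S(Q)|$ (resp. the same inequality for $Z_S(-)$, $N_S(-;X)$, $Z_S(-;X)$) for all $Q$ conjugate to $P$. Put $\mathrm{Aut}_S(P)=\{c_s|_P:s\in N_S(P)\}$, $\mathrm{Aut}_S(P;X)=\{(c_s|_P,\ell_s):s\in N_S(P)\}$, $\Sigma_{\mathfrak{X}}(P)=\{\sigma:\exists\varphi,(\varphi,\sigma)\in\mathfrak{X}(P)\}$, $\Sigma^S_{\mathfrak{X}}(P)=\{\ell_s:s\in N_S(P)\}$, $\mathcal{F}^{\mathfrak{X}}(P)_0=\{\varphi:(\varphi,\mathrm{id}_X)\in\mathfrak{X}(P)\}$, $\mathcal{F}_S(P)_0=\{c_s|_P:s\in N_S(P;X)\}$, $\Sigma_{\mathfrak{X}}(P)_0=\{\sigma:(\mathrm{id}_P,\sigma)\in\mathfrak{X}(P)\}$,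 $\Sigma^S_{\mathfrak{X}}(P)_0=\{\ell_s:s\in Z_S(P)\}$. The extender of $(\varphi,\sigma)\in\mathfrak{X}(P,Q)_{\mathrm{iso}}$ is $N_{(\varphi,\sigma)}=\{n\in N_S(P):(\varphi c_n\varphi^{-1},\sigma\ell_n\sigma^{-1})\in\mathrm{Aut}_S(Q;X)\}$. $\mathfrak{X}$ is saturated if: (1) for every $P\le S$, fully normalized implies fully $X$-normalized and fully centralized, and each of fully $X$-normalized and fully centralized implies fully $X$-centralized; (2) if $P$ is fully normalized then $\mathrm{Aut}_S(P)\in\mathrm{Syl}_p(\mathcal{F}^{\mathfrak{X}}(P))$, $\mathrm{Aut}_S(P;X)\in\mathrm{Syl}_p(\mathfrak{X}(P))$ and $\Sigma^S_{\mathfrak{X}}(P)\in\mathrm{Syl}_p(\Sigma_{\mathfrak{X}}(P))$; (3) if $P$ is fully $X$-normalized then $\mathcal{F}_S(P)_0\in\mathrm{Syl}_p(\mathcal{F}^{\mathfrak{X}}(P)_0)$; (4) if $P$ is fully centralized then $\Sigma^S_{\mathfrak{X}}(P)_0\in\mathrm{Syl}_p(\Sigma_{\mathfrak{X}}(P)_0)$; (5) if $Q$ is fully $X$-centralized and $(\varphi,\sigma)\in\mathfrak{X}(P,Q)_{\mathrm{iso}}$, there is $(\widetilde\varphi,\sigma)\in\mathfrak{X}(N_{(\varphi,\sigma)},S)$ with $\widetilde\varphi|_P=\varphi$. For a finite group $G\ge S$ acting on $X$ extending the $S$-action, $\mathfrak{X}_G=\mathfrak{X}_S(G)$ is the category whose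 objects are the subgroups of $S$ and whose morphisms $P\to Q$ are the pairs $(c_g|_P,\ell_g)$ with $g\in G$, $gPg^{-1}\le Q$. *)

(* Defs.v *)
From HB Require Import structures.
From mathcomp Require Import all_boot all_fingroup all_solvable.

Set Implicit Arguments.
Unset Strict Implicit.
Unset Printing Implicit Defensive.

Local Open Scope group_scope.

(* {perm T} composes from left to right: (s * t) x = t (s x).  Everything
   below concerns left actions, so lperm T is the symmetric group on T with
   the product (s * t) x = s (t x). *)
Record lperm (T : finType) : predArgType := LPerm {lpval : {perm T}}.
Arguments lperm T%_type.
Coercion lpval : lperm >-> perm_of.
HB.instance Definition _ (T : finType) := [isNew for @lpval T].
HB.instance Definition _ (T : finType) := [Finite of lperm T by <:].

Section LPerm.
Variable T : finType.

Definition lperm_mul (s t : lperm T) : lperm T := LPerm (lpval t * lpval s).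
Definition lperm_one : lperm T := LPerm 1.
Definition lperm_inv (s : lperm T) : lperm T := LPerm (lpval s)^-1.

Lemma lperm_mulA : associative lperm_mul.
Proof. by move=> s t u; rewrite /lperm_mul mulgA. Qed.
Lemma lperm_mul1 : left_id lperm_one lperm_mul.
Proof. by case=> s; rewrite /lperm_mul /lperm_one mulg1. Qed.
Lemma lperm_mulV : left_inverse lperm_one lperm_inv lperm_mul.
Proof. by move=> s; rewrite /lperm_mul /lperm_inv mulgV. Qed.

End LPerm.

HB.instance Definition _ (T : finType) := Finite_isGroup.Build (lperm T)
  (@lperm_mulA T) (@lperm_mul1 T) (@lperm_mulV T).

Section LPermTheory.
Variable T : finType.

Lemma lpermM (s t : lperm T) x : (s * t) x = s (t x).
Proof. exact: permM. Qed.

Lemma lperm1 x : (1 : lperm T) x = x.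
Proof. exact: perm1. Qed.

Lemma lpermP (s t : lperm T) : s =1 t <-> s = t.
Proof. by split=> [/permP st | -> //]; apply: val_inj. Qed.

End LPermTheory.

Record laction (S : finGroupType) (X : finType) := LAction {
  lact :> S -> X -> X;
  lact1 : forall x, lact 1 x = x;
  lactM : forall s t x, lact (s * t) x = lact s (lact t x)
}.

Arguments laction (S X)%_type.

Section Ell.
Variables (S : finGroupType) (X : finType) (act : laction S X).

Lemma lact_inj s : injective (act s).
Proof.
by apply: (can_inj (g := act s^-1)) => x; rewrite -lactM mulVg lact1.
Qed.

(* The permutation l_s : x |-> s . x. *)
Definition ell (s : S) : lperm X := LPerm (perm (@lact_inj s)).

Lemma ellE s x : ell s x = act s x.
Proof. by rewrite permE. Qed.

Lemma ellM : {morph ell : s t / s * t}.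
Proof. by move=> s t; apply/lpermP=> x; rewrite lpermM !ellE lactM. Qed.

Definition lfaithful := forall s : S, (forall x, act s x = x) -> s = 1.

End Ell.

(* A pair of a map P -> Q and a permutation of X. *)
Definition pmor (S : finGroupType) (X : finType) (P Q : {group S}) : Type :=
  ({ffun [subg P] -> [subg Q]} * lperm X)%type.

(* A choice of a set of pairs P -> Q for all subgroups P, Q of S: the morphism
   sets of a category whose objects are the subgroups of S. *)
Definition homsets (S : finGroupType) (X : finType) : Type :=
  forall P Q : {group S},
    {set pmor X P Q}.

Section FusionActionSystems.
Variables (S : finGroupType) (X : finType) (act : laction S X).
Implicit Types P Q R : {group S}.

Local Notation pmor := (pmor X).

Definition compM P Q R (g : pmor Q R) (f : pmor P Q) : pmor P R :=
  ([ffun x => g.1 (f.1 x)], g.2 * f.2).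

Definition idM P : pmor P P := ([ffun x => x], 1).

(* (incl, id_X) : P -> Q; only used for P \subset Q, as are the elements
   subg Q y below only for y \in Q. *)
Definition inclM P Q : pmor P Q := ([ffun x => subg Q (sgval x)], 1).

(* (c_s|_P, l_s) : P -> Q; only used when s P s^-1 is contained in Q.
   Note that x ^ s^-1 = s * x * s^-1 and P :^ s^-1 = s P s^-1. *)
Definition conjM P Q (s : S) : pmor P Q :=
  ([ffun x => subg Q (sgval x ^ s^-1)], ell act s).

Definition inj_hom P Q (phi : {ffun [subg P] -> [subg Q]}) : bool :=
  injectiveb phi && [forall x, forall y, phi (x * y) == phi x * phi y].

Definition intertwined P Q (f : pmor P Q) : bool :=
  [forall x : [subg P],
     f.2 * ell act (sgval x) * f.2^-1 == ell act (sgval (f.1 x))].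

Definition homU : homsets S X := fun P Q =>
  [set f | inj_hom f.1 && intertwined f].

Definition homS : homsets S X := fun P Q =>
  [set conjM P Q s | s : S & P :^ s^-1 \subset Q].

Definition isos (H : homsets S X) P Q : {set pmor P Q} :=
  [set f in H P Q |
    [exists g in H Q P, (compM g f == idM P) && (compM f g == idM Q)]].

(* The identities belong to homS, hence to every fusion action system. *)
Record fusion_action_system := FusionActionSystem {
  fas_hom :> forall P Q, {set pmor P Q};
  fas_sub : forall P Q, fas_hom P Q \subset homU P Q;
  fas_sup : forall P Q, homS P Q \subset fas_hom P Q;
  fas_comp : forall P Q R (g : pmor Q R) (f : pmor P Q),
    g \in fas_hom Q R -> f \in fas_hom P Q -> compM g f \in fas_hom P R;
  fas_factor : forall P Q (f : pmor P Q), f \in fas_hom P Q ->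
    exists R (g : pmor P R),
      [/\ R \subset Q, g \in isos fas_hom P R & f = compM (inclM R Q) g]
}.

Definition core : {set S} := [set s | ell act s == 1].

Section Saturation.
Variables (p : nat) (FX : fusion_action_system).

Definition homF P Q : {set {ffun [subg P] -> [subg Q]}} :=
  [set phi | [exists sigma, (phi, sigma) \in FX P Q]].

Definition conjugateF P Q : bool :=
  [exists phi in homF P Q, exists psi in homF Q P,
     [forall x, psi (phi x) == x] && [forall y, phi (psi y) == y]].

Definition fully (n : {group S} -> {set S}) P : Prop :=
  forall Q, conjugateF P Q -> #|n Q| <= #|n P|.

(* 'C(P) is the centralizer of P in S. *)
Definition fully_normalized := fully (fun P => 'N(P)).
Definition fully_centralized := fully (fun P => 'C(P)).
Definition fully_X_normalized := fully (fun P => 'N(P) :&: core).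
Definition fully_X_centralized := fully (fun P => 'C(P) :&: core).

(* Endomorphisms in FX are injective, hence FX P P is a group of pairs of
   permutations; these are its elements seen in a finGroupType. *)
Definition pmor_of P (u : lperm [subg P] * lperm X) : pmor P P :=
  ([ffun x => u.1 x], u.2).

Definition autX P : {set lperm [subg P] * lperm X} :=
  [set u | pmor_of u \in FX P P].
Definition autF P : {set lperm [subg P]} :=
  [set phi | [exists sigma, (phi, sigma) \in autX P]].
Definition SigmaX P : {set lperm X} :=
  [set sigma | [exists phi, (phi, sigma) \in autX P]].
Definition autF0 P : {set lperm [subg P]} :=
  [set phi | (phi, 1) \in autX P].
Definition SigmaX0 P : {set lperm X} :=
  [set sigma | (1, sigma) \in autX P].

Definition autSX P : {set lperm [subg P] * lperm X} :=
  [set u | [exists s in 'N(P), pmor_of u == conjM P P s]].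
Definition autS P : {set lperm [subg P]} :=
  [set phi : lperm [subg P] |
    [exists s in 'N(P), [ffun x => phi x] == (conjM P P s).1]].
Definition SigmaS P : {set lperm X} := ell act @: 'N(P).
Definition autS0 P : {set lperm [subg P]} :=
  [set phi : lperm [subg P] |
    [exists s in 'N(P) :&: core, [ffun x => phi x] == (conjM P P s).1]].
Definition SigmaS0 P : {set lperm X} := ell act @: 'C(P).

(* The condition f c_n f^-1 \in Aut_S(Q; X), multiplied by f on the right. *)
Definition extender P Q (f : pmor P Q) : {set S} :=
  [set n in 'N(P) |
    [exists u in autSX Q, compM (pmor_of u) f == compM f (conjM P P n)]].

Lemma compMA P Q R T (h : pmor R T) (g : pmor Q R) (f : pmor P Q) :
  compM h (compM g f) = compM (compM h g) f.
Proof. by congr (_, _); [apply/ffunP=> x; rewrite !ffunE | exact: mulgA]. Qed.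

Lemma pmor_ofM P (u v : lperm [subg P] * lperm X) :
  pmor_of (u * v) = compM (pmor_of u) (pmor_of v).
Proof. by congr (_, _); apply/ffunP=> x; rewrite !ffunE lpermM. Qed.

Lemma ell1 : ell act 1 = 1.
Proof. by apply/lpermP=> x; rewrite ellE lact1 lperm1. Qed.

Lemma conjM1 P : conjM P P 1 = idM P.
Proof.
by congr (_, _); [apply/ffunP=> x; rewrite !ffunE invg1 conjg1 sgvalK | exact: ell1].
Qed.

Lemma conjM_mul P (s t : S) : t \in 'N(P) ->
  conjM P P (s * t) = compM (conjM P P s) (conjM P P t).
Proof.
move=> Nt; congr (_, _); last exact: ellM.
apply/ffunP=> x; rewrite !ffunE /= subgK ?invMg ?conjgM //.
by rewrite memJ_norm ?groupV ?subgP.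
Qed.

Lemma pmor_of1 P : pmor_of (1 : lperm [subg P] * lperm X) = idM P.
Proof. by congr (_, _); apply/ffunP=> x; rewrite !ffunE lperm1. Qed.

Lemma comp1M P Q (f : pmor P Q) : compM (idM Q) f = f.
Proof.
case: f => phi s; congr (_, _); last exact: mul1g.
by apply/ffunP=> x; rewrite !ffunE.
Qed.

Lemma compM1 P Q (f : pmor P Q) : compM f (idM P) = f.
Proof.
case: f => phi s; congr (_, _); last exact: mulg1.
by apply/ffunP=> x; rewrite !ffunE.
Qed.

Lemma autSX_group_set P : group_set (autSX P).
Proof.
apply/group_setP; split.
  rewrite inE; apply/existsP; exists 1.
  by rewrite group1 conjM1 pmor_of1 eqxx.
move=> u v; rewrite !inE => /exists_inP[s Ns /eqP us] /exists_inP[t Nt /eqP vt].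
apply/exists_inP; exists (s * t); first exact: groupM.
by rewrite pmor_ofM us vt conjM_mul.
Qed.

Lemma extender_group_set P Q (f : pmor P Q) : group_set (extender f).
Proof.
have gQ := autSX_group_set Q; pose G := Group gQ.
apply/group_setP; split.
  rewrite inE group1; apply/exists_inP; exists 1; first exact: (group1 G).
  by rewrite conjM1 pmor_of1 comp1M compM1.
move=> m n /setIdP[Nm /exists_inP[u Gu /eqP um]].
case/setIdP=> Nn /exists_inP[v Gv /eqP vn].
apply/setIdP; split; first exact: groupM.
apply/exists_inP; exists (u * v); first exact: (groupM (G := G)).
by rewrite pmor_ofM conjM_mul // compMA -um -!compMA -vn.
Qed.
Canonical extender_group P Q (f : pmor P Q) := Group (extender_group_set f).

Record saturated : Prop := Saturated {
  sat_fully : forall P,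
    [/\ fully_normalized P -> fully_X_normalized P /\ fully_centralized P,
        fully_X_normalized P -> fully_X_centralized P
      & fully_centralized P -> fully_X_centralized P];
  (* Both arguments of each Sylow condition below are subgroups. *)
  sat_normalized : forall P, fully_normalized P ->
    [/\ p.-Sylow(autF P) (autS P), p.-Sylow(autX P) (autSX P)
      & p.-Sylow(SigmaX P) (SigmaS P)];
  sat_X_normalized : forall P, fully_X_normalized P ->
    p.-Sylow(autF0 P) (autS0 P);
  sat_centralized : forall P, fully_centralized P ->
    p.-Sylow(SigmaX0 P) (SigmaS0 P);
  sat_extend : forall P Q (f : pmor P Q),
    fully_X_centralized Q -> f \in isos FX P Q ->
    let N := extender_group f in
    exists phi : {ffun [subg N] -> [subg [set: S]]},
      (phi, f.2) \in FX N [set: S]%G /\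
      forall x : [subg P], sgval (phi (subg N (sgval x))) = sgval (f.1 x)
}.

Lemma SigmaX_group_set P : group_set (SigmaX P).
Proof.
apply/group_setP; split.
  rewrite inE; apply/existsP; exists 1; rewrite inE.
  rewrite [pmor_of _]pmor_of1 -conjM1; apply: (subsetP (fas_sup FX P P)).
  by apply/imsetP; exists 1; rewrite // inE invg1 conjsg1.
move=> s t; rewrite !inE => /existsP[phi]; rewrite inE => sX.
case/existsP=> psi; rewrite inE => tX.
apply/existsP; exists (phi * psi); rewrite inE.
by rewrite (pmor_ofM (phi, s) (psi, t)) fas_comp.
Qed.
Canonical SigmaX_group P := Group (SigmaX_group_set P).

(* FX(1), identified with a subgroup of the symmetric group on X through the
   second projection (the trivial group has a single automorphism). *)
Definition autX1 : {group lperm X} := SigmaX_group 1.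

Lemma ell_autX1 s : ell act s \in autX1.
Proof.
rewrite inE; apply/existsP; exists 1; rewrite inE.
apply: (subsetP (fas_sup FX _ _)); apply/imsetP; exists s.
  by rewrite inE conjs1g.
congr (_, _); apply/ffunP=> x; rewrite !ffunE; apply: val_inj => /=.
by have /set1P-> := subgP (subg 1 (sgval x ^ s^-1));
  have /set1P-> := subgP ((1 : lperm [subg 1]) x).
Qed.

End Saturation.

(* A finite group G with S <= G, the inclusion being given by an injective
   homomorphism, and an action of G on X extending that of S. *)
Record overgroup := Overgroup {
  ov_group : finGroupType;
  ov_incl : S -> ov_group;
  ov_inclM : {morph ov_incl : s t / s * t};
  ov_incl_inj : injective ov_incl;
  ov_act : laction ov_group X;
  ov_actE : forall s x, ov_act (ov_incl s) x = act s x
}.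

(* The pairs (c_g|_P, l_g) with g in G and g P g^-1 <= Q. *)
Definition homG (G : overgroup) : homsets S X := fun P Q =>
  [set f : pmor P Q | [exists g : ov_group G,
    [&& (@ov_incl G @: P) :^ g^-1 \subset @ov_incl G @: Q,
        [forall x, ov_incl G (sgval (f.1 x)) == ov_incl G (sgval x) ^ g^-1]
      & f.2 == ell (ov_act G) g]]].

Section NaturalOvergroup.
Variables (FX : fusion_action_system) (faithS : lfaithful act).

Lemma natural_act1 (x : X) : sgval (1 : [subg autX1 FX]) x = x.
Proof. exact: lperm1. Qed.

Lemma natural_actM (g h : [subg autX1 FX]) (x : X) :
  sgval (g * h) x = sgval g (sgval h x).
Proof. exact: lpermM. Qed.

Definition natural_act : laction [subg autX1 FX] X :=
  @LAction _ _ (fun g : [subg autX1 FX] => sgval g)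
    natural_act1 natural_actM.

Definition natural_incl (s : S) : [subg autX1 FX] := Subg (ell_autX1 FX s).

Lemma natural_inclM : {morph natural_incl : s t / s * t}.
Proof. by move=> s t; apply: val_inj; apply: ellM. Qed.

Lemma natural_incl_inj : injective natural_incl.
Proof.
move=> s t /(congr1 sgval) /= est; apply/eqP; rewrite eq_mulVg1; apply/eqP.
apply: faithS => x; rewrite lactM -(ellE act t) -est ellE -lactM.
by rewrite mulVg lact1.
Qed.

Lemma natural_actE s x : natural_act (natural_incl s) x = act s x.
Proof. exact: ellE. Qed.

(* G = FX(1) with its natural action on X, and S identified with a subgroup
   of G through s |-> l_s. *)
Definition natural_overgroup : overgroup :=
  Overgroup natural_inclM natural_incl_inj natural_actE.

End NaturalOvergroup.

End FusionActionSystems.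

(* Main.v *)
Require Import Defs.
From mathcomp Require Import all_boot all_fingroup all_solvable.

(** Since [S] acts faithfully, [ell act] is injective, so the relation
    [sigma * ell x * sigma^-1 = ell (phi x)] lets the permutation [sigma] of an
    intertwined pair [(phi, sigma)] determine [phi]: it is conjugation by
    [sigma].  Hence the homsets of [X_G], for [G = X(1)], consist exactly of the
    intertwined pairs whose permutation belongs to [X(1)] ([mem_homG]), and it
    remains to see that these are the morphisms of [X].

    A morphism of [X] restricts to the trivial subgroup, which puts its
    permutation in [X(1)] ([fas_perm_autX1]).

    Conversely, let [(phi, sigma) : P -> Q] be intertwined with [sigma] in
    [X(1)].  Then [(id, sigma)] is an automorphism of the trivial subgroup in
    [X].  By faithfulness the core is trivial, so every subgroup is fully
    X-centralized and the extension axiom applies to [(id, sigma)].  Its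
    extender consists of the [n] in [S] for which [sigma * ell n * sigma^-1]
    is again some [ell s]; it therefore contains [P].  Restricting the extension
    to [P] gives a morphism [P -> S] of [X] with permutation [sigma], whose
    underlying map must be [phi].  Its image lies in [Q], and the factorization
    of morphisms of [X] into isomorphisms and inclusions lets the target be cut
    down from [S] to [Q] ([fas_corestrict]). *)

Set Implicit Arguments.
Unset Strict Implicit.
Unset Printing Implicit Defensive.

Local Open Scope group_scope.

Section Realization.
Variables (S : finGroupType) (X : finType) (act : laction S X).
Variable FX : fusion_action_system act.
Implicit Types P Q R : {group S}.

Local Notation trivS := (1%G : {group S}).

Lemma intertwinedP P Q (f : pmor X P Q) :
  reflect (forall x, f.2 * ell act (sgval x) * f.2^-1 = ell act (sgval (f.1 x)))
          (intertwined act f).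
Proof. exact: 'forall_eqP. Qed.

Lemma fas_intertwined P Q (f : pmor X P Q) :
  f \in FX P Q -> intertwined act f.
Proof. by move/(subsetP (fas_sub FX P Q)); rewrite inE => /andP[]. Qed.

Lemma inclM_fas P Q : P \subset Q -> inclM X P Q \in FX P Q.
Proof.
move=> sPQ; apply: (subsetP (fas_sup FX P Q)); apply/imsetP; exists 1.
  by rewrite inE invg1 conjsg1.
congr (_, _); last by rewrite ell1.
by apply/ffunP=> x; rewrite !ffunE invg1 conjg1.
Qed.

(** The isomorphism in the factorization of [f] maps onto the image of [f], so
    it can be followed by the inclusion of that image in any [R] containing
    it. *)
Lemma fas_corestrict P Q R (f : pmor X P Q) :
    f \in FX P Q -> (forall x, sgval (f.1 x) \in R) ->
  ([ffun x => subg R (sgval (f.1 x))], f.2) \in FX P R.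
Proof.
move=> Ff fR; have [T [g [sTQ iso_g def_f]]] := fas_factor Ff.
have /setIdP[Fg /exists_inP[h _ /andP[_ ghK]]] := iso_g.
have fg x : sgval (f.1 x) = sgval (g.1 x).
  by rewrite def_f !ffunE subgK ?(subsetP sTQ) ?subgP.
have sTR : T \subset R.
  apply/subsetP=> y Ty; have [/ffunP/(_ (subg T y))] := eqP ghK.
  by rewrite !ffunE => /(congr1 sgval); rewrite -fg subgK // => <-.
suff -> : ([ffun x => subg R (sgval (f.1 x))], f.2) = compM (inclM X T R) g.
  exact: fas_comp (inclM_fas sTR) Fg.
congr (_, _); last by rewrite def_f.
by apply/ffunP=> x; rewrite !ffunE fg.
Qed.

Lemma eq_ffun_subg1 P (phi psi : {ffun [subg P] -> [subg trivS]}) :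
  phi = psi.
Proof.
apply/ffunP=> x; apply: val_inj => /=.
by have /set1P-> := subgP (phi x); have /set1P-> := subgP (psi x).
Qed.

(** The trivial group has a single endomorphism, so the first component of an
    endomorphism of it in [FX] can be chosen at will. *)
Lemma mem_autX1 sigma (phi : {ffun [subg trivS] -> [subg trivS]}) :
  (sigma \in autX1 FX) = ((phi, sigma) \in FX trivS trivS).
Proof.
rewrite inE; apply/existsP/idP=> [[u] | Fs].
  by rewrite inE (_ : pmor_of _ = (phi, sigma)) //; congr (_, _); apply: eq_ffun_subg1.
exists 1; rewrite inE (_ : pmor_of _ = (phi, sigma)) //; congr (_, _).
exact: eq_ffun_subg1.
Qed.

(** The restriction of [f] to the trivial subgroup has trivial image, so it
    corestricts to an endomorphism of that subgroup with the same
    permutation. *)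
Lemma fas_perm_autX1 P Q (f : pmor X P Q) : f \in FX P Q -> f.2 \in autX1 FX.
Proof.
move=> Ff; have F1 := fas_comp Ff (inclM_fas (sub1G P)).
have /andP[_ /forallP fM] : inj_hom f.1.
  by have := subsetP (fas_sub FX P Q) _ Ff; rewrite inE => /andP[].
have f1 : f.1 1 = 1.
  by apply: (mulgI (f.1 1)); rewrite mulg1 -(eqP (forallP (fM 1) 1)) mulg1.
have := fas_corestrict (R := trivS) F1; rewrite /= mulg1 -mem_autX1; apply=> x.
rewrite !ffunE; have /set1P-> := subgP x.
by rewrite (_ : subg P 1 = 1) ?f1 ?group1 //; apply: val_inj; rewrite /= subgK.
Qed.

Hypothesis faithS : lfaithful act.

Lemma ell_inj : injective (ell act).
Proof.
by move=> s t est; apply: (natural_incl_inj (FX := FX) faithS); apply: val_inj.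
Qed.

Lemma core1 : core act = 1.
Proof.
by apply/setP=> s; rewrite !inE -(ell1 act) (inj_eq ell_inj).
Qed.

Lemma fully_X_centralized_faithful P : fully_X_centralized FX P.
Proof. by move=> Q _; rewrite core1 !setIg1. Qed.

Lemma ell_natural (g : [subg autX1 FX]) :
  ell (natural_act FX) g = sgval g.
Proof. by apply/lpermP=> x; rewrite ellE. Qed.

(** In [natural_overgroup] the element [s] of [S] is [ell act s], so the formula
    [f.1 x = g x g^-1] with [g = f.2] is the intertwining relation; it forces
    [g P g^-1] into [Q] because [f.1] takes its values in [Q]. *)
Lemma mem_homG P Q (f : pmor X P Q) :
  (f \in homG (natural_overgroup FX faithS) P Q) =
    (f.2 \in autX1 FX) && intertwined act f.
Proof.
rewrite inE; apply/existsP/andP=> [[g /and3P[_ /forallP fg /eqP f2]] | [Gf2 fI]].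
  rewrite f2 /= ell_natural subgP; split=> //; apply/intertwinedP=> x.
  have := eqP (fg x); rewrite conjgE invgK => /(congr1 sgval) /= ->.
  by rewrite f2 ell_natural mulgA.
pose g : [subg autX1 FX] := Subg Gf2; exists g; rewrite /= ell_natural eqxx andbT.
have fg x : natural_incl FX (sgval (f.1 x)) = natural_incl FX (sgval x) ^ g^-1.
  rewrite conjgE invgK; apply: val_inj => /=.
  by rewrite -(intertwinedP f fI) mulgA.
apply/andP; split; last by apply/forallP=> x; rewrite fg.
apply/subsetP=> _ /imsetP[_ /imsetP[x Px ->] ->]; apply/imsetP.
by exists (sgval (f.1 (subg P x))); rewrite ?subgP ?fg ?subgK.
Qed.

Variable p : nat.
Hypothesis satX : saturated p FX.

(** The extension axiom turns an automorphism of the trivial subgroup into a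
    morphism with the same permutation defined on all of [P]; by faithfulness
    no other underlying map than [f.1] is compatible with that permutation. *)
Lemma intertwined_autX1_fas P Q (f : pmor X P Q) :
  f.2 \in autX1 FX -> intertwined act f -> f \in FX P Q.
Proof.
move=> Gf2 /intertwinedP fI.
pose f1 : pmor X trivS trivS := ((idM X trivS).1, f.2).
have iso_f1 : f1 \in isos FX trivS trivS.
  rewrite inE -mem_autX1 Gf2; apply/exists_inP; exists ((idM X trivS).1, f.2^-1).
    by rewrite -mem_autX1 groupV.
  apply/andP; split; apply/eqP; congr (_, _) => /=;
    by rewrite ?mulVg ?mulgV //; apply: eq_ffun_subg1.
(* Over the trivial subgroup the extender condition only concerns
   permutations: [sigma * ell n * sigma^-1] must be some [ell s].  The
   intertwining relation provides [s = f.1 n]. *)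
have sPN : P \subset extender_group act f1.
  apply/subsetP=> n Pn; pose s := sgval (f.1 (subg P n)).
  have Nn t : t \in 'N(trivS) by rewrite norm1 inE.
  rewrite inE Nn; apply/exists_inP; exists (1, ell act s).
    rewrite inE; apply/exists_inP; exists s => //.
    by apply/eqP; congr (_, _); apply: eq_ffun_subg1.
  apply/eqP; congr (_, _); first exact: eq_ffun_subg1.
  by rewrite /= -fI subgK // mulgKV.
have cent1 := fully_X_centralized_faithful (P := trivS).
have [phi [Fphi _]] := sat_extend satX cent1 iso_f1.
have Fpsi := fas_comp Fphi (inclM_fas sPN).
set psi := compM _ _ in Fpsi.
have psi2 : psi.2 = f.2 by rewrite /= mulg1.
have psi1 x : sgval (psi.1 x) = sgval (f.1 x).
  by apply: ell_inj; rewrite -fI -(intertwinedP _ (fas_intertwined Fpsi)) psi2.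
suff -> : f = ([ffun x => subg Q (sgval (psi.1 x))], psi.2).
  by apply: fas_corestrict Fpsi _ => x; rewrite psi1 subgP.
rewrite psi2; case: (f) psi1 => phi0 sigma /= psi1; congr (_, _).
by apply/ffunP=> x; rewrite ffunE psi1 sgvalK.
Qed.

End Realization.

Theorem corollary2p3p2 (p : nat) (S : finGroupType) (X : finType)
    (act : laction S X) (FX : fusion_action_system act)
    (p_prime : prime p) (pS : p.-group [set: S])
    (satX : saturated p FX) (faithS : lfaithful act) :
  forall P Q : {group S}, FX P Q = homG (natural_overgroup FX faithS) P Q.
Proof.
move=> P Q; apply/setP=> f; rewrite mem_homG; apply/idP/andP=> [Ff | [Gf2 fI]].
  by split; [apply: fas_perm_autX1 Ff | apply: fas_intertwined Ff].
exact: intertwined_autX1_fas satX _ _ _ Gf2 fI.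
Qed.
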